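(* Let $n\in\mathbb{N}\cup\{\infty\}$, $n\geq2$, and let $\underline{\Gamma}$ be an $n$-monotone exact functional defined on a linear lattice of gambles on a non-empty set $\Omega$ that contains all constant gambles. Then the natural extension $\underline{E}_{\underline{\Gamma}}$ is $n$-monotone, is comonotone additive, and is equal to the Choquet integral with respect to the restriction to events of the inner extension $\underline{\Gamma}_*$, i.e. $\underline{E}_{\underline{\Gamma}}(f)=(C)\int f\,\mathrm{d}\underline{\Gamma}_*$ for all gambles $f$ on $\Omega$.
   Context: $\mathbb{N}=\{1,2,\dots\}$. A gamble on $\Omega$ is a bounded real-valued map on $\Omega$; $\mathcal{L}$ is the set of all gambles, with pointwise operations and order; a real number $\mu$ also denotes the constant gamble $\mu$. An event $A\subseteq\Omega$ is identified with its indicator gamble $I_A$; $\underline{\Gamma}_*(A)$ means $\underline{\Gamma}_*(I_A)$. A functional is a real-valued map defined on a subset of $\mathcal{L}$ (its domain, $\operatorname{dom}$). A functional on $\mathcal{L}$ is exact if for all $f,g\in\mathcal{L}$, real $\lambda\geq0$ and real $\mu$: (E1) $f\geq g$ implies $\underline{\Gamma}(f)\geq\underline{\Gamma}(g)$; (E2) $\underline{\Gamma}(\lambda f)=\lambda\underline{\Gamma}(f)$; (E3) $\underline{\Gamma}(f+g)\geq\underline{\Gamma}(f)+\underline{\Gamma}(g)$; (E4) $\underline{\Gamma}(f+\mu)=\underline{\Gamma}(f)+\underline{\Gamma}(\mu)$. A functional on an arbitrary subset of $\mathcal{L}$ is exact if it can be extended to an exact functional on $\mathcal{L}$. Norm: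 $\|\underline{\Gamma}\|$ is the infimum of all $c\geq0$ such that for all $m\in\mathbb{N}$, $\lambda_1,\dots,\lambda_m\geq0$, $\lambda\in\mathbb{R}$ and $f,f_1,\dots,f_m\in\operatorname{dom}\underline{\Gamma}$: $f\geq\sum_{k=1}^m\lambda_kf_k+\lambda$ implies $\underline{\Gamma}(f)\geq\sum_{k=1}^m\lambda_k\underline{\Gamma}(f_k)+\lambda c$. (Known: finite if and only if $\underline{\Gamma}$ is exact, and equal to $\underline{\Gamma}(1)$ if $\underline\Gamma$ is exact and $1\in\operatorname{dom}\underline{\Gamma}$.) Natural extension of an exact $\underline{\Gamma}$: the functional on $\mathcal{L}$ given by $\underline{E}_{\underline{\Gamma}}(f)=\sup\{\sum_{k=1}^m\lambda_k\underline{\Gamma}(f_k)+\lambda\|\underline{\Gamma}\| : m\in\mathbb{N},\lambda_k\geq0,\lambda\in\mathbb{R},f_k\in\operatorname{dom}\underline{\Gamma},\sum_{k=1}^m\lambda_kf_k+\lambda\leq f\}$. (Known: it is an exact extension of $\underline\Gamma$ with the same norm.) A linear lattice is a linear subspace of $\mathcal{L}$ closed under pointwise minimum $\wedge$ and maximum $\vee$. A functional on a lattice of gambles is $n$-monotone if for all $p\in\mathbb{N}$, $p\leq n$, and all $f,f_1,\dots,f_p$ in its domain, $\sum_{I\subseteq\{1,\dots,p\}}(-1)^{|I|}\underline{\Gamma}(f\wedge\bigwedge_{i\in I}f_i)\geq0$ (for $I=\emptyset$ the term $\bigwedge_{i\in I}f_i$ is dropped). Gambles $f,g$ are comonotone if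 for all $\omega_1,\omega_2\in\Omega$, $f(\omega_1)<f(\omega_2)$ implies $g(\omega_1)\leq g(\omega_2)$. A functional is comonotone additive if it is additive on all comonotone pairs $f,g$ in its domain. Inner extension: $\underline{\Gamma}_*(f)=\sup\{\underline{\Gamma}(g): g\in\operatorname{dom}\underline{\Gamma},\ g\leq f\}$ for all $f\in\mathcal{L}$. Choquet integral: for a monotone real-valued set function $\mu$ on the power set of $\Omega$ with $\mu(\emptyset)=0$, $(C)\int f\,\mathrm{d}\mu=\mu(\Omega)\inf f+(R)\int_{\inf f}^{\sup f}\mu(\{f\geq x\})\,\mathrm{d}x$ for every gamble $f$, where $(R)\int$ is the Riemann integral and $\{f\geq x\}=\{\omega\in\Omega:f(\omega)\geq x\}$. *)

(* Defs.v *)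
(* Stdlib reals and Coquelicot; finite sums and meets use MathComp's bigop. *)
From Stdlib Require Export Reals ClassicalEpsilon.
From Coquelicot Require Export Coquelicot.
From mathcomp Require Export ssreflect ssrfun ssrbool eqtype ssrnat fintype finset bigop.

Set Implicit Arguments.
Unset Strict Implicit.
Unset Printing Implicit Defensive.

Open Scope R_scope.

Definition gamble (Omega : Type) (f : Omega -> R) : Prop :=
  exists M : R, forall w, Rabs (f w) <= M.

Definition gle (Omega : Type) (f g : Omega -> R) : Prop := forall w, f w <= g w.
Definition gconst (Omega : Type) (mu : R) : Omega -> R := fun _ => mu.
Definition gadd (Omega : Type) (f g : Omega -> R) : Omega -> R := fun w => f w + g w.
Definition gscale (Omega : Type) (a : R) (f : Omega -> R) : Omega -> R := fun w => a * f w.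
Definition gmin (Omega : Type) (f g : Omega -> R) : Omega -> R := fun w => Rmin (f w) (g w).
Definition gmax (Omega : Type) (f g : Omega -> R) : Omega -> R := fun w => Rmax (f w) (g w).

Definition indicator (Omega : Type) (A : Omega -> Prop) : Omega -> R :=
  fun w => if excluded_middle_informative (A w) then 1 else 0.

Definition ginf (Omega : Type) (f : Omega -> R) : R :=
  real (Glb_Rbar (fun y => exists w, y = f w)).
Definition gsup (Omega : Type) (f : Omega -> R) : R :=
  real (Lub_Rbar (fun y => exists w, y = f w)).

(* The values of [val] outside [dom] are irrelevant: every notion below
   evaluates a functional only at members of its domain. *)
Record functional (Omega : Type) : Type := Functional {
  dom : (Omega -> R) -> Prop;
  val :> (Omega -> R) -> R;
  dom_gamble : forall f, dom f -> gamble f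
}.

(* A functional whose domain is the set of all gambles. *)
Definition total_functional (Omega : Type) (v : (Omega -> R) -> R) : functional Omega :=
  @Functional Omega (@gamble Omega) v (fun _ H => H).

Definition extends (Omega : Type) (G' G : functional Omega) : Prop :=
  forall f, dom G f -> dom G' f /\ G' f = G f.

Record exact_on_gambles (Omega : Type) (G : functional Omega) : Prop := ExactOnGambles {
  exact_dom : forall f, gamble f -> dom G f;
  exact_mono : forall f g, gamble f -> gamble g -> gle g f -> G g <= G f;
  exact_homo : forall f (lam : R), gamble f -> 0 <= lam ->
    G (gscale lam f) = lam * G f;
  exact_superadd : forall f g, gamble f -> gamble g -> G f + G g <= G (gadd f g);
  exact_const : forall f (mu : R), gamble f ->
    G (gadd f (gconst mu)) = G f + G (gconst mu)
}.

Definition exact (Omega : Type) (G : functional Omega) : Prop :=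
  exists G' : functional Omega, exact_on_gambles G' /\ extends G' G.

(* Extended-real valued; [p_infty] when no [c] qualifies. *)
Definition functional_norm (Omega : Type) (G : functional Omega) : Rbar :=
  Glb_Rbar (fun c => 0 <= c /\
    forall (m : nat) (lam : 'I_m -> R) (l : R) (f : Omega -> R) (F : 'I_m -> Omega -> R),
      (0 < m)%N -> (forall k, 0 <= lam k) -> dom G f -> (forall k, dom G (F k)) ->
      (forall w, \big[Rplus/0]_(k < m) (lam k * F k w) + l <= f w) ->
      \big[Rplus/0]_(k < m) (lam k * G (F k)) + l * c <= G f).

(* For an exact [G] the norm and the supremum are finite, so [real] only
   changes the type. *)
Definition natural_extension (Omega : Type) (G : functional Omega) : functional Omega :=
  total_functional (fun f => real (Lub_Rbar (fun y =>
    exists (m : nat) (lam : 'I_m -> R) (l : R) (F : 'I_m -> Omega -> R),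
      (0 < m)%N /\ (forall k, 0 <= lam k) /\ (forall k, dom G (F k)) /\
      (forall w, \big[Rplus/0]_(k < m) (lam k * F k w) + l <= f w) /\
      y = \big[Rplus/0]_(k < m) (lam k * G (F k)) + l * real (functional_norm G)))).

(* The supremum is finite when [G] is monotone and its domain contains the
   constant gambles. *)
Definition inner_extension (Omega : Type) (G : functional Omega) : functional Omega :=
  total_functional (fun f => real (Lub_Rbar (fun y =>
    exists g, dom G g /\ gle g f /\ y = G g))).

Record linear_lattice (Omega : Type) (D : (Omega -> R) -> Prop) : Prop := LinearLattice {
  lattice_gamble : forall f, D f -> gamble f;
  lattice_zero : D (gconst 0);
  lattice_add : forall f g, D f -> D g -> D (gadd f g);
  lattice_scale : forall (a : R) f, D f -> D (gscale a f);
  lattice_min : forall f g, D f -> D g -> D (gmin f g);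
  lattice_max : forall f g, D f -> D g -> D (gmax f g)
}.

(* Orders of monotonicity: [Some k] is the natural number k, [None] is infinity. *)
Definition le_order (p : nat) (n : option nat) : Prop :=
  match n with Some k => (p <= k)%N | None => True end.

(* Starting the iterated minimum from [f] yields the meet of [f] with all
   [F i], i in I, and [f] itself for empty I. *)
Definition n_monotone (Omega : Type) (n : option nat) (G : functional Omega) : Prop :=
  forall p : nat, (1 <= p)%N -> le_order p n ->
  forall (f : Omega -> R) (F : 'I_p -> Omega -> R),
    dom G f -> (forall i, dom G (F i)) ->
    0 <= \big[Rplus/0]_(I : {set 'I_p})
           ((-1) ^ #|I| * G (\big[@gmin Omega/f]_(i in I) F i)).

Definition comonotone (Omega : Type) (f g : Omega -> R) : Prop :=
  forall w1 w2, f w1 < f w2 -> g w1 <= g w2.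

Definition comonotone_additive (Omega : Type) (G : functional Omega) : Prop :=
  forall f g, dom G f -> dom G g -> dom G (gadd f g) -> comonotone f g ->
    G (gadd f g) = G f + G g.

Definition monotone_set_function (Omega : Type) (mu : (Omega -> Prop) -> R) : Prop :=
  forall A B : Omega -> Prop, (forall w, A w -> B w) -> mu A <= mu B.

(* [c] is the Choquet integral of [f] with respect to [mu]; this includes the
   conditions on [mu] under which that integral is defined, and the existence
   of the Riemann integral. *)
Definition is_Choquet (Omega : Type) (mu : (Omega -> Prop) -> R) (f : Omega -> R) (c : R)
    : Prop :=
  monotone_set_function mu /\ mu (fun _ => False) = 0 /\
  exists J : R,
    is_RInt (fun x => mu (fun w => x <= f w)) (ginf f) (gsup f) J /\
    c = mu (fun _ => True) * ginf f + J.

Definition restrict_to_events (Omega : Type) (G : functional Omega)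
    : (Omega -> Prop) -> R :=
  fun A => G (indicator A).

(* Main.v *)
(* A norm computation (testing against the constants 1 and -1 leaves c = G 1 as
   the only admissible bound) shows that the natural extension is the inner
   extension T, which inherits exactness and n-monotonicity by approximation
   from below.  For an exact T, superadditivity of f = (f /\ t) + (f - t)^+ gives
   T (f /\ t) + T ((f - t)^+) <= T f, while 2-monotonicity applied to f and the
   constant t gives the converse.  Hence t |-> T (f /\ t) grows over [a, b] by
   T of a slice lying between (b - a) I_{f >= b} and (b - a) I_{f >= a}: it is a
   primitive of the decreasing function x |-> T {f >= x}, which is the Choquet
   formula.  Comonotone additivity follows from the uniqueness of that integral. *)
From HB Require Import structures.
From Stdlib Require Import Lra Classical FunctionalExtensionality.
From mathcomp Require Import seq.
Require Import Defs.

Set Implicit Arguments.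
Unset Strict Implicit.
Unset Printing Implicit Defensive.

HB.instance Definition _ :=
  Monoid.isComLaw.Build R 0 Rplus
    (fun x y z => esym (Rplus_assoc x y z)) Rplus_comm Rplus_0_l.

(** * Riemann integrals obtained from bounds on increments *)

(** On each cell the term of the Riemann sum and the increment of [F] lie between the same two
    bounds, so they differ by at most [d] times the drop of [m] across the cell. These drops
    telescope. *)
Lemma Riemann_sum_increment_bound (m F : R -> R) (d : R) (s : SF_seq) :
  (forall x y, x <= y -> m y * (y - x) <= F y - F x <= m x * (y - x)) ->
  pointed_subdiv s -> seq_step (SF_lx s) <= d ->
  Rabs (Riemann_sum m s - (F (seq.last (SF_h s) (SF_lx s)) - F (SF_h s)))
    <= d * (m (SF_h s) - m (seq.last (SF_h s) (SF_lx s))) /\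
  m (seq.last (SF_h s) (SF_lx s)) <= m (SF_h s).
Proof.
move=> bounds.
have anti x y : x <= y -> m y <= m x.
  case=> [xy|->]; last exact: Rle_refl.
  apply: (Rmult_le_reg_r (y - x)); first lra.
  by case: (bounds x y); lra.
move: s; apply: (@SF_cons_ind R) => [x0|[x t] s IH] pt step.
  rewrite /= /Riemann_sum /= /zero /=; split; last exact: Rle_refl.
  by rewrite !Rminus_diag Rabs_R0; lra.
have /= pt0 := pt 0%nat ltac:(rewrite SF_size_cons; apply PeanoNat.Nat.lt_0_succ).
have {}pt := ptd_cons _ _ pt.
rewrite Riemann_sum_cons /= /plus /scal /= /mult /=.
move: step; rewrite /seq_step /= => step.
have step1 := Rle_trans _ _ _ (Rmax_l _ _) step.
have step2 := Rle_trans _ _ _ (Rmax_r _ _) step.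
case: (IH pt step2) => {IH} IH IHm.
move: IH IHm; rewrite /=; set l := seq.last _ _ => IH IHm.
have xy : x <= SF_h s by lra.
move: step1; rewrite Rabs_pos_eq; last lra.
move=> step1.
have b := bounds x (SF_h s) xy.
have mt1 := anti x t ltac:(lra).
have mt2 := anti t (SF_h s) ltac:(lra).
split; last lra.
have h1 := Rmult_le_compat_l (SF_h s - x) _ _ ltac:(lra) mt1.
have h2 := Rmult_le_compat_l (SF_h s - x) _ _ ltac:(lra) mt2.
have h3 := Rmult_le_compat_r (m x - m (SF_h s)) _ _ ltac:(lra) step1.
move: IH => /Rabs_le_between IH; apply/Rabs_le_between.
nra.
Qed.

(** The error of a Riemann sum is at most the mesh times [m a - m b], so it vanishes with the mesh.
    Thus [F] serves as a primitive of [m] even where [m] jumps. *)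
Lemma is_RInt_of_increment_bounds (m F : R -> R) (a b : R) :
  a <= b ->
  (forall x y, x <= y -> m y * (y - x) <= F y - F x <= m x * (y - x)) ->
  is_RInt m a b (F b - F a).
Proof.
(* The degenerate interval is separate because the factor [sign (b - a)] in the definition of the
   integral is 1 only for [a < b]. *)
move=> ab bounds; case: (Req_dec a b) => [<-|neq].
  rewrite Rminus_diag; exact: is_RInt_point.
have mab : 0 <= m a - m b.
  have := bounds a b ab => h.
  have: m b * (b - a) <= m a * (b - a) by lra.
  move/(Rmult_le_reg_r _ _ _ (ltac:(lra) : 0 < b - a)); lra.
apply/filterlim_locally => eps.
(* The added 1 keeps the denominator positive when [m a = m b]. *)
have d0 : 0 < eps / (m a - m b + 1).
  apply: Rdiv_lt_0_compat; [exact: cond_pos | lra].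
exists (mkposreal _ d0) => s /= step [pt [sa sb]].
move: sa sb; rewrite Rmin_left // Rmax_right // => sa sb.
have [+ _] := Riemann_sum_increment_bound bounds pt (Rlt_le _ _ step).
rewrite /= sb sa => bnd.
rewrite sign_eq_1; last lra.
rewrite /ball /= /AbsRing_ball /abs /minus /plus /opp /scal /= /mult /= Rmult_1_l.
apply: (Rle_lt_trans _ _ _ bnd).
have e0 := cond_pos eps.
rewrite /Rdiv Rmult_assoc -[X in _ < X]Rmult_1_r; apply: Rmult_lt_compat_l => //.
apply: (Rmult_lt_reg_l (m a - m b + 1)); first lra.
rewrite -Rmult_assoc Rinv_r; lra.
Qed.

(** * Pointwise order, gambles and indicators *)

Lemma gle_antisym (Omega : Type) (f g : Omega -> R) : gle f g -> gle g f -> f = g.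
Proof. move=> fg gf; extensionality w; exact: Rle_antisym (fg w) (gf w). Qed.

Lemma gle_trans (Omega : Type) (f g h : Omega -> R) : gle f g -> gle g h -> gle f h.
Proof. move=> fg gh w; exact: Rle_trans (fg w) (gh w). Qed.

Lemma gle_refl (Omega : Type) (f : Omega -> R) : gle f f.
Proof. move=> w; exact: Rle_refl. Qed.

Lemma gle_gmin (Omega : Type) (f g h : Omega -> R) :
  gle h (gmin f g) <-> gle h f /\ gle h g.
Proof.
split=> [le|[hf hg] w]; last exact: Rmin_glb.
by split=> w; have := le w; rewrite /gmin;
  have := Rmin_l (f w) (g w); have := Rmin_r (f w) (g w); lra.
Qed.

Lemma gmax_gle (Omega : Type) (f g h : Omega -> R) :
  gle (gmax f g) h <-> gle f h /\ gle g h.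
Proof.
split=> [le|[hf hg] w]; last exact: Rmax_lub.
by split=> w; have := le w; rewrite /gmax;
  have := Rmax_l (f w) (g w); have := Rmax_r (f w) (g w); lra.
Qed.

Lemma gambles_lattice (Omega : Type) : linear_lattice (@gamble Omega).
Proof.
split=> //.
- by exists 0 => w; rewrite Rabs_R0; lra.
- move=> f g [M fM] [N gN]; exists (M + N) => w.
  by have := Rabs_triang (f w) (g w); have := fM w; have := gN w; rewrite /gadd; lra.
- move=> a f [M fM]; exists (Rabs a * M) => w; rewrite /gscale.
  rewrite Rabs_mult; apply: Rmult_le_compat_l; [exact: Rabs_pos | exact: fM].
- move=> f g [M fM] [N gN]; exists (M + N) => w.
  have := fM w; have := gN w; have := Rabs_pos (f w); have := Rabs_pos (g w).
  by rewrite /gmin /Rmin; case: Rle_dec; lra.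
- move=> f g [M fM] [N gN]; exists (M + N) => w.
  have := fM w; have := gN w; have := Rabs_pos (f w); have := Rabs_pos (g w).
  by rewrite /gmax /Rmax; case: Rle_dec; lra.
Qed.

Lemma gamble_const (Omega : Type) (mu : R) : gamble (@gconst Omega mu).
Proof. exists (Rabs mu) => w; exact: Rle_refl. Qed.

Lemma gamble_indicator (Omega : Type) (A : Omega -> Prop) : gamble (indicator A).
Proof.
exists 1 => w; rewrite /indicator.
by case: excluded_middle_informative => ?; rewrite ?Rabs_R0 ?Rabs_R1; lra.
Qed.

Lemma gle_indicator (Omega : Type) (A B : Omega -> Prop) :
  (forall w, A w -> B w) -> gle (indicator A) (indicator B).
Proof.
move=> AB w; rewrite /indicator.
case: (excluded_middle_informative (A w)) => Aw;
  case: (excluded_middle_informative (B w)) => Bw /=; try lra.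
by case: Bw; apply: AB.
Qed.

Lemma indicator_True (Omega : Type) : indicator (fun _ : Omega => True) = gconst 1.
Proof. by extensionality w; rewrite /indicator; case: excluded_middle_informative. Qed.

Lemma indicator_False (Omega : Type) : indicator (fun _ : Omega => False) = gconst 0.
Proof. by extensionality w; rewrite /indicator; case: excluded_middle_informative. Qed.

(** * Iterated meets and joins *)

(** This universal property lets iterated meets be compared without regard to the order in which the
    fold visits the indices. *)
Lemma gle_bigmin (Omega : Type) (I : finType) (P : pred I) (f : Omega -> R)
    (F : I -> Omega -> R) (h : Omega -> R) :
  gle h (\big[@gmin Omega/f]_(i | P i) F i) <->
  gle h f /\ (forall i, P i -> gle h (F i)).
Proof.
split=> [|[hf hF]]; last first.
  apply: big_ind => // x y hx hy; exact/gle_gmin.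
(* Quantifying over the enumeration of the index type makes the claim provable by induction on that
   list. *)
have -> : (gle h f /\ (forall i, P i -> gle h (F i))) <->
   (gle h f /\ (forall i, i \in index_enum I -> P i -> gle h (F i))).
  by split=> -[? H]; split=> // i; [move=> _|]; apply: H; rewrite mem_index_enum.
elim: (index_enum I) => [|i r IH]; first by rewrite big_nil; split.
rewrite big_cons; case: ifPn => Pi.
  move/gle_gmin => [hi /IH[hf hr]]; split=> // j.
  by rewrite seq.in_cons => /orP[/eqP->|]; auto.
move/IH => [hf hr]; split=> // j.
by rewrite seq.in_cons => /orP[/eqP->|]; [rewrite (negPf Pi)|auto].
Qed.

Lemma bigmax_gle (Omega : Type) (I : finType) (P : pred I) (f : Omega -> R)
    (F : I -> Omega -> R) (h : Omega -> R) :
  gle (\big[@gmax Omega/f]_(i | P i) F i) h <->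
  gle f h /\ (forall i, P i -> gle (F i) h).
Proof.
split=> [|[hf hF]]; last first.
  apply: (big_ind (fun x => gle x h)) => // x y hx hy; exact/gmax_gle.
have -> : (gle f h /\ (forall i, P i -> gle (F i) h)) <->
   (gle f h /\ (forall i, i \in index_enum I -> P i -> gle (F i) h)).
  by split=> -[? H]; split=> // i; [move=> _|]; apply: H; rewrite mem_index_enum.
elim: (index_enum I) => [|i r IH]; first by rewrite big_nil; split.
rewrite big_cons; case: ifPn => Pi.
  move/gmax_gle => [hi /IH[hf hr]]; split=> // j.
  by rewrite seq.in_cons => /orP[/eqP->|]; auto.
move/IH => [hf hr]; split=> // j.
by rewrite seq.in_cons => /orP[/eqP->|]; [rewrite (negPf Pi)|auto].
Qed.

(** * Sums over subsets of two indices, and supermodularity *)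

Lemma big_gmin_set0 (Omega : Type) (p : nat) (f : Omega -> R) (F : 'I_p -> Omega -> R) :
  \big[@gmin Omega/f]_(i in set0) F i = f.
Proof. by rewrite big_pred0 // => i; rewrite inE. Qed.

Lemma big_gmin_set1 (Omega : Type) (p : nat) (f : Omega -> R) (F : 'I_p -> Omega -> R)
    (j : 'I_p) :
  \big[@gmin Omega/f]_(i in [set j]) F i = gmin f (F j).
Proof.
apply: gle_antisym.
  have [hf hF] := (gle_bigmin (fun i => i \in [set j]) f F _).1 (@gle_refl _ _).
  by apply/gle_gmin; split=> //; apply: hF; rewrite inE.
have [hf hF] := (gle_gmin f (F j) _).1 (@gle_refl _ _).
by apply/gle_bigmin; split=> // i; rewrite inE => /eqP->.
Qed.

Lemma big_gmin_setT2 (Omega : Type) (f : Omega -> R) (F : 'I_2 -> Omega -> R) :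
  \big[@gmin Omega/f]_(i in setT) F i = gmin f (gmin (F ord0) (F ord_max)).
Proof.
apply: gle_antisym.
  have [hf hF] := (gle_bigmin (fun i => i \in [set: 'I_2]) f F _).1 (@gle_refl _ _).
  by apply/gle_gmin; split=> //; apply/gle_gmin; split; apply: hF; rewrite inE.
have [hf /gle_gmin[h0 h1]] := (gle_gmin f _ _).1 (@gle_refl _ (gmin f (gmin (F ord0) (F ord_max)))).
apply/gle_bigmin; split=> // i _.
case: i => [[|[|//]] lt].
  by rewrite (_ : Ordinal lt = ord0) //; apply: val_inj.
by rewrite (_ : Ordinal lt = ord_max) //; apply: val_inj.
Qed.

Lemma sum_subsets_I2 (a : {set 'I_2} -> R) :
  \big[Rplus/0]_(I : {set 'I_2}) a I =
  a set0 + (a [set ord0] + (a [set ord_max] + a setT)).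
Proof.
have ne01 : [set ord0] != [set ord_max] :> {set 'I_2}.
  by apply/negP => /eqP /setP /(_ ord0); rewrite !inE.
have neT (j : 'I_2) : setT != [set j].
  by apply/negP => /eqP /(congr1 (fun A : {set _} => #|A|)); rewrite cardsT card_ord cards1.
have ne0 (j : 'I_2) : [set j] != set0.
  by apply/negP => /eqP /(congr1 (fun A : {set _} => #|A|)); rewrite cards0 cards1.
have neT0 : setT != set0 :> {set 'I_2}.
  by apply/negP => /eqP /(congr1 (fun A : {set _} => #|A|)); rewrite cardsT card_ord cards0.
rewrite (bigD1 set0) //= (bigD1 [set ord0]) ?ne0 //=.
rewrite (bigD1 [set ord_max]) ?ne0 //=; last by rewrite eq_sym.
rewrite (bigD1 setT) ?neT0 ?neT //=.
rewrite big1 ?Rplus_0_r // => A /andP[/andP[/andP[A0 A1] A2] A3].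
exfalso.
have all2 (P : pred 'I_2) : P ord0 -> P ord_max -> forall i, P i.
  move=> P0 P1 [[|[|//]] lt].
    by rewrite (_ : Ordinal lt = ord0) //; apply: val_inj.
  by rewrite (_ : Ordinal lt = ord_max) //; apply: val_inj.
(* Membership of the two indices determines [A], so [A] is one of the four sets already split
   off. *)
case h0: (ord0 \in A); case h1: (ord_max \in A).
- by case/eqP: A3; apply/setP => i; apply/eqP; move: i; apply: all2; rewrite !inE ?h0 ?h1.
- by case/eqP: A1; apply/setP => i; apply/eqP; move: i; apply: all2; rewrite !inE ?h0 ?h1.
- by case/eqP: A2; apply/setP => i; apply/eqP; move: i; apply: all2; rewrite !inE ?h0 ?h1.
- by case/eqP: A0; apply/setP => i; apply/eqP; move: i; apply: all2; rewrite !inE ?h0 ?h1.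
Qed.

Definition supermodular (Omega : Type) (T : functional Omega) : Prop :=
  forall f g, dom T f -> dom T g -> dom T (gmax f g) ->
    T f + T g <= T (gmax f g) + T (gmin f g).

(** Take [p = 2] and the base gamble [gmax f g]: by absorption its meets with [f], with [g] and with
    both are [f], [g] and [gmin f g], with signs -1, -1 and 1. *)
Lemma n_monotone_supermodular (Omega : Type) (n : option nat) (T : functional Omega) :
  le_order 2 n -> n_monotone n T -> supermodular T.
Proof.
move=> n2 mono f g df dg dfg.
pose F (i : 'I_2) := if i == ord0 then f else g.
have dF i : dom T (F i) by rewrite /F; case: ifP.
have := mono 2%nat isT n2 (gmax f g) F dfg dF.
rewrite sum_subsets_I2 big_gmin_set0 !big_gmin_set1 big_gmin_setT2.
rewrite cards0 !cards1 cardsT card_ord /F /=.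
have -> : gmin (gmax f g) f = f.
  by extensionality w; rewrite /gmin /gmax Rmin_right //; apply: Rmax_l.
have -> : gmin (gmax f g) g = g.
  by extensionality w; rewrite /gmin /gmax Rmin_right //; apply: Rmax_r.
have -> : gmin (gmax f g) (gmin f g) = gmin f g.
  extensionality w; rewrite /gmin /gmax Rmin_right //.
  exact: Rle_trans (Rmin_l _ _) (Rmax_l _ _).
lra.
Qed.

(** * Consequences of exactness on the domain *)

Lemma gle_exact (Omega : Type) (G : functional Omega) (f g : Omega -> R) :
  exact G -> dom G f -> dom G g -> gle f g -> G f <= G g.
Proof.
move=> [T [Tex ext]] df dg fg.
rewrite -(proj2 (ext f df)) -(proj2 (ext g dg)).
by apply: (exact_mono Tex) => //; apply: dom_gamble; eassumption.
Qed.

Lemma exact_gscale (Omega : Type) (G : functional Omega) (a : R) (f : Omega -> R) :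
  exact G -> dom G f -> dom G (gscale a f) -> 0 <= a -> G (gscale a f) = a * G f.
Proof.
move=> [T [Tex ext]] df daf a0.
rewrite -(proj2 (ext _ daf)) -(proj2 (ext f df)).
by apply: (exact_homo Tex) => //; apply: dom_gamble; eassumption.
Qed.

Lemma exact_gadd (Omega : Type) (G : functional Omega) (f g : Omega -> R) :
  exact G -> dom G f -> dom G g -> dom G (gadd f g) -> G f + G g <= G (gadd f g).
Proof.
move=> [T [Tex ext]] df dg dfg.
rewrite -(proj2 (ext _ dfg)) -(proj2 (ext f df)) -(proj2 (ext g dg)).
by apply: (exact_superadd Tex) => //; apply: dom_gamble; eassumption.
Qed.

Lemma exact_on_gambles_gconst (Omega : Type) (T : functional Omega) (mu : R) :
  exact_on_gambles T -> T (gconst mu) = mu * T (gconst 1).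
Proof.
move=> Tex.
have pos (a : R) : 0 <= a -> T (gconst a) = a * T (gconst 1).
  move=> a0; rewrite -(exact_homo Tex) //; last exact: gamble_const.
  by congr (T _); extensionality w; rewrite /gscale /gconst Rmult_1_r.
case: (Rle_dec 0 mu) => [/pos //|neg].
(* For negative [mu], constant additivity on [- mu + mu = 0] reduces the claim to the positive
   constant [- mu]. *)
have := exact_const Tex mu (gamble_const Omega (- mu)).
have -> : gadd (gconst (- mu)) (gconst mu) = gconst 0 :> (Omega -> R).
  by extensionality w; rewrite /gadd /gconst; lra.
rewrite (pos 0) ?(pos (- mu)); lra.
Qed.

Lemma exact_gconst (Omega : Type) (G : functional Omega) (mu : R) :
  exact G -> (forall c, dom G (gconst c)) -> G (gconst mu) = mu * G (gconst 1).
Proof.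
move=> [T [Tex ext]] dc.
rewrite -(proj2 (ext _ (dc mu))) -(proj2 (ext _ (dc 1))).
exact: exact_on_gambles_gconst.
Qed.

Lemma exact_weighted_sum (Omega : Type) (G : functional Omega) (m : nat)
    (lam : 'I_m -> R) (F : 'I_m -> Omega -> R) :
  exact G -> linear_lattice (dom G) ->
  (forall k, 0 <= lam k) -> (forall k, dom G (F k)) ->
  exists2 g, dom G g &
    (forall w, g w = \big[Rplus/0]_(k < m) (lam k * F k w)) /\
    \big[Rplus/0]_(k < m) (lam k * G (F k)) <= G g.
Proof.
move=> Gex Dlat lam0 dF.
exists (\big[@gadd Omega/gconst 0]_(k < m) gscale (lam k) (F k)).
  apply: big_ind; first exact: lattice_zero Dlat.
    by move=> f g; apply: (lattice_add Dlat).
  by move=> k _; apply: (lattice_scale Dlat).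
split; first by move=> w; apply: (big_morph (fun g => g w)).
have [//] : dom G (\big[@gadd Omega/gconst 0]_(k < m) gscale (lam k) (F k)) /\
  \big[Rplus/0]_(k < m) (lam k * G (F k)) <=
  G (\big[@gadd Omega/gconst 0]_(k < m) gscale (lam k) (F k)).
apply: (big_ind2 (fun y g => dom G g /\ y <= G g)).
- have d0 := lattice_zero Dlat; split=> //.
  have e : gscale 0 (gconst 0) = gconst 0 :> (Omega -> R).
    by extensionality w; rewrite /gscale Rmult_0_l.
  by rewrite -e exact_gscale ?e //; lra.
- move=> x f y g [df xf] [dg yg].
  have dfg := lattice_add Dlat df dg; split=> //.
  by have := exact_gadd Gex df dg dfg; lra.
- move=> k _; have d := lattice_scale Dlat (lam k) (dF k); split=> //.
  by rewrite exact_gscale //; apply: Rle_refl.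
Qed.

(** An affine combination of members of the domain is itself a member, and superadditivity and
    homogeneity bound its value from below. The combinations in the norm and in the natural
    extension thereby reduce to single gambles. *)
Lemma exact_affine_le (Omega : Type) (G : functional Omega) (m : nat)
    (lam : 'I_m -> R) (l : R) (F : 'I_m -> Omega -> R) :
  exact G -> linear_lattice (dom G) -> (forall c, dom G (gconst c)) ->
  (forall k, 0 <= lam k) -> (forall k, dom G (F k)) ->
  exists2 g, dom G g &
    (forall w, g w = \big[Rplus/0]_(k < m) (lam k * F k w) + l) /\
    \big[Rplus/0]_(k < m) (lam k * G (F k)) + l * G (gconst 1) <= G g.
Proof.
move=> Gex Dlat dc lam0 dF.
have [g dg [gE gle]] := exact_weighted_sum Gex Dlat lam0 dF.
have dgl := lattice_add Dlat dg (dc l).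
exists (gadd g (gconst l)) => //; split=> [w|]; first by rewrite /gadd gE.
have := exact_gadd Gex dg (dc l) dgl.
by rewrite (exact_gconst l Gex dc); lra.
Qed.

(** * Norm and natural extension on a lattice with constants *)

(** Testing an admissible [c] with [l = -1] and the constant gamble -1 gives [G (gconst 1) <= c].
    Conversely [G (gconst 1)] is admissible by [exact_affine_le] and monotonicity. *)
Lemma functional_norm_gconst (Omega : Type) (G : functional Omega) :
  inhabited Omega ->
  exact G -> linear_lattice (dom G) -> (forall c, dom G (gconst c)) ->
  functional_norm G = G (gconst 1).
Proof.
move=> [w0] Gex Dlat dc; apply: is_glb_Rbar_unique.
have G0 : G (gconst 0) = 0 by rewrite (exact_gconst 0 Gex dc); lra.
split.
  move=> c [_ H] /=.
  have := H 1%nat (fun _ => 0) 1 (gconst 1) (fun _ => gconst 0) isT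
    (fun _ => Rle_refl 0) (dc 1) (fun _ => dc 0).
  have := H 1%nat (fun _ => 0) (-1) (gconst (-1)) (fun _ => gconst 0) isT
    (fun _ => Rle_refl 0) (dc (-1)) (fun _ => dc 0).
  rewrite !big_ord_recl !big_ord0 (exact_gconst (-1) Gex dc) => H1 _.
  have : 0 * G (gconst 0) + 0 + -1 * c <= -1 * G (gconst 1).
    by apply: H1 => w; rewrite big_ord_recl big_ord0 /gconst; lra.
  lra.
move=> b; apply; split.
  by rewrite -G0; apply: gle_exact => // w; rewrite /gconst; lra.
move=> m lam l f F _ lam0 df dF le.
have [g dg [gE ge]] := exact_affine_le l Gex Dlat dc lam0 dF.
apply: (Rle_trans _ _ _ ge); apply: gle_exact => // w; rewrite gE; exact: le.
Qed.

(** The two suprema dominate each other: [exact_affine_le] replaces each affine combination by one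
    minorant of at least its value, and each minorant is the combination with one coefficient 1 and
    [l = 0]. *)
Lemma natural_extension_inner (Omega : Type) (G : functional Omega) :
  inhabited Omega ->
  exact G -> linear_lattice (dom G) -> (forall c, dom G (gconst c)) ->
  natural_extension G = inner_extension G.
Proof.
move=> inh Gex Dlat dc; congr total_functional; extensionality f; congr real.
have lub1 := Lub_Rbar_correct (fun y => exists g, dom G g /\ gle g f /\ y = G g).
apply: is_lub_Rbar_unique; split.
  move=> y [m [lam [l [F [_ [lam0 [dF [le ->]]]]]]]].
  rewrite (functional_norm_gconst inh Gex Dlat dc).
  have [g dg [gE ge]] := exact_affine_le l Gex Dlat dc lam0 dF.
  apply: (Rbar_le_trans _ (G g)); first exact: ge.
  by apply: (proj1 lub1); exists g; split=> //; split=> // w; rewrite gE.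
move=> b ub; apply: (proj2 lub1) => y [g [dg [gf ->]]].
apply: ub; exists 1%nat, (fun _ => 1), 0, (fun _ => g).
split=> //; split=> [_|]; first lra.
split=> //; split=> [w|]; rewrite big_ord_recl big_ord0; last lra.
by have := gf w; lra.
Qed.

(** * The inner extension and its exactness *)

(** A member and an upper bound exclude the infinite values, on which [real] would return the
    default 0. *)
Lemma real_Lub_Rbar (E : R -> Prop) (y0 M : R) :
  E y0 -> (forall y, E y -> y <= M) ->
  (forall y, E y -> y <= real (Lub_Rbar E)) /\
  (forall eps, 0 < eps -> exists2 y, E y & real (Lub_Rbar E) - eps < y).
Proof.
move=> E0 EM; have [ub lub] := Lub_Rbar_correct E.
move: ub lub; have := @conj.
case L: (Lub_Rbar E) => [l||] _ ub lub.
- split=> [y Ey|eps eps0]; first exact: ub.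
  apply: NNPP => none; have /= : Rbar_le l (l - eps).
    apply: lub => y Ey /=; apply: Rnot_lt_le => lt; apply: none.
    by exists y.
  lra.
- by have := lub M EM.
- by have := ub _ E0.
Qed.

Lemma gamble_bounds (Omega : Type) (f : Omega -> R) :
  gamble f -> exists M, gle (gconst (- M)) f /\ gle f (gconst M).
Proof.
move=> [M fM]; exists M; split=> w; have /Rabs_le_between := fM w; rewrite /gconst; lra.
Qed.

(** For a bound [M] of [f], the constant [- M] is a minorant in the domain and [G (gconst M)] bounds
    all candidate values, so the supremum is finite. *)
Lemma inner_extension_spec (Omega : Type) (G : functional Omega) (f : Omega -> R) :
  exact G -> (forall c, dom G (gconst c)) -> gamble f ->
  (forall g, dom G g -> gle g f -> G g <= inner_extension G f) /\
  (forall eps, 0 < eps ->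
     exists2 g, dom G g /\ gle g f & inner_extension G f - eps < G g).
Proof.
move=> Gex dc /gamble_bounds [M [lo up]].
have [|y|ub app] := @real_Lub_Rbar
    (fun y => exists g, dom G g /\ gle g f /\ y = G g)
    (G (gconst (- M))) (G (gconst M)).
- by exists (gconst (- M)).
- move=> [g [dg [gf ->]]]; apply: gle_exact => //; exact: gle_trans gf up.
split=> [g dg gf|eps eps0]; first by apply: ub; exists g.
by have [_ [g [dg [gf ->]]] ge] := app eps eps0; exists g.
Qed.

Lemma le_of_forall_eps (x y : R) : (forall eps, 0 < eps -> x - eps <= y) -> x <= y.
Proof. move=> H; apply: le_epsilon => eps /H; lra. Qed.

Lemma inner_extension_gle (Omega : Type) (G : functional Omega) (f g : Omega -> R) :
  exact G -> (forall c, dom G (gconst c)) -> gamble f -> gamble g -> gle f g ->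
  inner_extension G f <= inner_extension G g.
Proof.
move=> Gex dc gf gg fg; apply: le_of_forall_eps => eps eps0.
have [h [dh hf] hge] := proj2 (inner_extension_spec Gex dc gf) eps eps0.
have := proj1 (inner_extension_spec Gex dc gg) h dh (gle_trans hf fg); lra.
Qed.

(** Near-optimal minorants can be added and scaled within the domain, which gives one inequality for
    each operation; a constant is its own best minorant. *)
Lemma inner_extension_exact (Omega : Type) (G : functional Omega) :
  exact G -> linear_lattice (dom G) -> (forall c, dom G (gconst c)) ->
  exact_on_gambles (inner_extension G).
Proof.
move=> Gex Dlat dc; have L := gambles_lattice Omega.
have spec f gf := @inner_extension_spec Omega G f Gex dc gf.
have const c : inner_extension G (gconst c) = G (gconst c).
  have gc := gamble_const Omega c; apply: Rle_antisym.
    apply: le_of_forall_eps => eps eps0.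
    have [h [dh hf] hge] := proj2 (spec _ gc) eps eps0.
    have := gle_exact Gex dh (dc c) hf; lra.
  exact: (proj1 (spec _ gc) _ (dc c) (@gle_refl _ _)).
have add f g : gamble f -> gamble g ->
    inner_extension G f + inner_extension G g <= inner_extension G (gadd f g).
  move=> gf gg; apply: le_of_forall_eps => eps eps0.
  have [h [dh hf] hge] := proj2 (spec _ gf) (eps / 2) ltac:(lra).
  have [k [dk kg] kge] := proj2 (spec _ gg) (eps / 2) ltac:(lra).
  have dhk := lattice_add Dlat dh dk.
  have := exact_gadd Gex dh dk dhk.
  have := proj1 (spec _ (lattice_add L gf gg)) _ dhk
    (fun w => Rplus_le_compat _ _ _ _ (hf w) (kg w)).
  lra.
have scale_le f a : gamble f -> 0 < a ->
    a * inner_extension G f <= inner_extension G (gscale a f).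
  move=> gf a0; apply: le_of_forall_eps => eps eps0.
  have [h [dh hf] hge] := proj2 (spec _ gf) (eps / a) ltac:(exact: Rdiv_lt_0_compat).
  have dah := lattice_scale Dlat a dh.
  have := proj1 (spec _ (lattice_scale L a gf)) _ dah
    (fun w => Rmult_le_compat_l _ _ _ (Rlt_le _ _ a0) (hf w)).
  rewrite exact_gscale //; last lra.
  have := Rmult_lt_compat_l a _ _ a0 hge.
  have -> : a * (inner_extension G f - eps / a) = a * inner_extension G f - eps.
    by field; lra.
  lra.
have G0 : G (gconst 0) = 0 by rewrite (exact_gconst 0 Gex dc); lra.
split=> //.
- by move=> f g gf gg; apply: inner_extension_gle.
- move=> f a gf [a0|<-]; last first.
    have -> : gscale 0 f = gconst 0 by extensionality w; rewrite /gscale Rmult_0_l.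
    by rewrite const G0; lra.
  apply: Rle_antisym; last exact: scale_le.
  (* The converse inequality comes from undoing the scaling with [/ a]. *)
  have := scale_le (gscale a f) (/ a) (lattice_scale L a gf) (Rinv_0_lt_compat _ a0).
  have -> : gscale (/ a) (gscale a f) = f.
    by extensionality w; rewrite /gscale -Rmult_assoc Rinv_l; lra.
  move/(Rmult_le_compat_l a _ _ (Rlt_le _ _ a0)).
  by rewrite -Rmult_assoc Rinv_r; lra.
- move=> f mu gf; apply: Rle_antisym; last exact: add (gamble_const _ _).
  (* Superadditivity after adding back [- mu] gives the converse inequality. *)
  have := add _ _ (lattice_add L gf (gamble_const Omega mu)) (gamble_const Omega (- mu)).
  have -> : gadd (gadd f (gconst mu)) (gconst (- mu)) = f.
    by extensionality w; rewrite /gadd /gconst; lra.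
  rewrite !const (exact_gconst (- mu) Gex dc) (exact_gconst mu Gex dc); lra.
Qed.

(** * Approximation from below and n-monotonicity *)

(** Coefficients of absolute value at most 1 let each term lose at most [eps]; the sum of ones
    counts the terms. *)
Lemma sum_approx (I : finType) (s a b : I -> R) (eps : R) :
  (forall i, Rabs (s i) <= 1) -> (forall i, Rabs (a i - b i) <= eps) ->
  \big[Rplus/0]_i (s i * b i) - eps * \big[Rplus/0]_(i : I) 1
    <= \big[Rplus/0]_i (s i * a i).
Proof.
move=> s1 ab.
rewrite (big_morph (Rmult eps) (Rmult_plus_distr_l eps) (Rmult_0_r eps)).
apply: (big_ind3 (fun x y z => x - y <= z)); first lra.
  by move=> x1 x2 x3 y1 y2 y3; lra.
move=> i _; have := Rmult_le_compat _ _ _ _ (Rabs_pos _) (Rabs_pos _) (s1 i) (ab i).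
by rewrite -Rabs_mult => /Rabs_le_between; lra.
Qed.

Lemma choice_fun (A B : Type) (P : A -> B -> Prop) :
  (forall a, exists b, P a b) -> exists f, forall a, P a (f a).
Proof.
move=> H; exists (fun a => proj1_sig (constructive_indefinite_description _ (H a))).
by move=> a; apply: proj2_sig.
Qed.

(* For each I choose g_I in the domain below f /\ \bigwedge_(i in I) F_i and
   nearly optimal there; g = \bigvee_I g_I and h_i = \bigvee_(I : i in I) g_I
   then approximate all these meets simultaneously, since
   g_I <= g /\ \bigwedge_(i in I) h_i <= f /\ \bigwedge_(i in I) F_i. *)
Lemma inner_extension_n_monotone (Omega : Type) (n : option nat) (G : functional Omega) :
  exact G -> linear_lattice (dom G) -> (forall c, dom G (gconst c)) ->
  n_monotone n G -> n_monotone n (inner_extension G).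
Proof.
move=> Gex Dlat dc mono p p1 pn f F df dF.
have spec g gg := @inner_extension_spec Omega G g Gex dc gg.
have L := gambles_lattice Omega.
pose meet (I : {set 'I_p}) := \big[@gmin Omega/f]_(i in I) F i.
have gmeet I : gamble (meet I).
  apply: (big_ind (@gamble Omega)) => [//|x y|i _]; [exact: (lattice_min L)|exact: dF].
set K := \big[Rplus/0]_(I : {set 'I_p}) 1.
have K0 : 0 <= K by apply: big_ind => *; lra.
apply: le_of_forall_eps => eps eps0.
(* [K] counts the subsets, so errors of [eps / (K + 1)] in all the meets add up to less than
   [eps]. *)
have eps1 : 0 < eps / (K + 1) by apply: Rdiv_lt_0_compat; lra.
have /choice_fun [g gP] : forall I, exists g, (dom G g /\ gle g (meet I)) /\
    inner_extension G (meet I) - eps / (K + 1) < G g.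
  by move=> I; have [g ? ?] := proj2 (spec _ (gmeet I)) _ eps1; exists g.
have gmeetP I : gle (g I) f /\ forall i, i \in I -> gle (g I) (F i).
  by apply/gle_bigmin; apply gP.
(* The folds need an initial gamble. [g setT] already belongs to each of these joins, since every
   [i] lies in [setT], so it changes no value. *)
pose g0 := \big[@gmax Omega/g setT]_I g I.
pose h i := \big[@gmax Omega/g setT]_(I : {set 'I_p} | i \in I) g I.
have dmax (P : pred {set 'I_p}) : dom G (\big[@gmax Omega/g setT]_(I | P I) g I).
  apply: big_ind => [|x y|I _]; try by apply gP.
  exact: (lattice_max Dlat).
have dmin (I : {set 'I_p}) : dom G (\big[@gmin Omega/g0]_(i in I) h i).
  apply: (big_ind (dom G)) => [|x y|i _]; last exact: dmax.
    exact: dmax.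
  exact: (lattice_min Dlat).
have le_meet (I : {set 'I_p}) : gle (\big[@gmin Omega/g0]_(i in I) h i) (meet I).
  apply: (big_ind2 (@gle Omega)).
  - by apply/bigmax_gle; split=> [|J _]; apply gmeetP.
  - move=> x1 x2 y1 y2 le1 le2.
    have [lx ly] := (gle_gmin x1 y1 _).1 (@gle_refl _ _).
    by apply/gle_gmin; split; [exact: gle_trans lx le1 | exact: gle_trans ly le2].
  - move=> i _; apply/bigmax_gle; split=> [|J iJ].
      by apply gmeetP; rewrite inE.
    exact: (proj2 (gmeetP J)).
have ge_g (I : {set 'I_p}) : gle (g I) (\big[@gmin Omega/g0]_(i in I) h i).
  apply/gle_bigmin; split=> [|i iI].
    by have [_ ub] := (bigmax_gle predT (g setT) g _).1 (@gle_refl _ g0); apply: ub.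
  have [_ ub] := (bigmax_gle (fun I : {set 'I_p} => i \in I) (g setT) g _).1
    (@gle_refl _ (h i)).
  exact: ub.
have close (I : {set 'I_p}) : Rabs (inner_extension G (meet I) -
    G (\big[@gmin Omega/g0]_(i in I) h i)) <= eps / (K + 1).
  apply/Rabs_le_between; have [[dg gI] gap] := gP I.
  have := gle_exact Gex dg (dmin I) (ge_g I).
  have := proj1 (spec _ (gmeet I)) _ (dmin I) (le_meet I).
  lra.
have pos := mono p p1 pn g0 h (dmax _) (fun i => dmax _).
have := sum_approx (fun I : {set 'I_p} => Req_le _ _ (pow_1_abs #|I|)) close.
rewrite -/K => approx.
have epsK : eps / (K + 1) * K = eps - eps / (K + 1) by field; lra.
apply: Rle_trans approx; apply: Rplus_le_compat; first exact: pos.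
by rewrite epsK; lra.
Qed.

(** * Horizontal slices and the Choquet integral *)

(** With [k] the truncation of [f] at [b], the slice is [gmax k a] lowered by [a], and [k] is its
    sum with [gmin k a]. Superadditivity gives one inequality; supermodularity at [k] and the
    constant [a] gives the other. *)
Lemma exact_supermodular_slice (Omega : Type) (T : functional Omega)
    (f : Omega -> R) (a b : R) :
  exact_on_gambles T -> supermodular T -> gamble f -> a <= b ->
  T (gmin f (gconst b)) =
  T (gmin f (gconst a)) + T (fun w => Rmax (Rmin (f w) b) a - a).
Proof.
move=> Tex Tsup gf ab; have L := gambles_lattice Omega.
have gc c := gamble_const Omega c.
set k := gmin f (gconst b).
have gk : gamble k by exact: (lattice_min L).
have gkM : gamble (gmax k (gconst a)) by exact: (lattice_max L).
have gkm : gamble (gmin k (gconst a)) by exact: (lattice_min L).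
have kE : gmin k (gconst a) = gmin f (gconst a).
  extensionality w; rewrite /k /gmin /gconst /Rmin.
  by do !case: Rle_dec; lra.
have sE : (fun w => Rmax (Rmin (f w) b) a - a) = gadd (gmax k (gconst a)) (gconst (- a)).
  by [].
have gs : gamble (fun w => Rmax (Rmin (f w) b) a - a).
  by rewrite sE; exact: (lattice_add L).
have := exact_superadd Tex gkm gs.
have -> : gadd (gmin k (gconst a)) (fun w => Rmax (Rmin (f w) b) a - a) = k.
  extensionality w; rewrite /k /gadd /gmin /gconst /Rmin /Rmax.
  by do !case: Rle_dec; lra.
have := Tsup _ _ (exact_dom Tex gk) (exact_dom Tex (gc a)) (exact_dom Tex gkM).
rewrite sE (exact_const Tex) // (exact_on_gambles_gconst (- a) Tex).
by rewrite (exact_on_gambles_gconst a Tex) kE; lra.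
Qed.

(** The slice equals [b - a] on [P], vanishes off [Q] and stays between 0 and [b - a]. Arbitrary
    events [P] and [Q] allow level sets of a gamble other than [f], as comonotone additivity
    requires. *)
Lemma truncation_increment_bounds (Omega : Type) (T : functional Omega)
    (f : Omega -> R) (P Q : Omega -> Prop) (a b : R) :
  exact_on_gambles T -> supermodular T -> gamble f -> a <= b ->
  (forall w, P w -> b <= f w) -> (forall w, a < f w -> Q w) ->
  T (indicator P) * (b - a) <= T (gmin f (gconst b)) - T (gmin f (gconst a))
    <= T (indicator Q) * (b - a).
Proof.
move=> Tex Tsup gf ab Pf fQ; have L := gambles_lattice Omega.
have gc c := gamble_const Omega c.
rewrite (exact_supermodular_slice Tex Tsup gf ab).
have gs : gamble (fun w => Rmax (Rmin (f w) b) a - a).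
  apply: (lattice_add L _ (gc (- a))).
  by apply: (lattice_max L _ (gc a)); exact: (lattice_min L _ (gc b)).
have sc A := exact_homo Tex (gamble_indicator A) (ltac:(lra) : 0 <= b - a).
have gi A := lattice_scale L (b - a) (gamble_indicator A).
rewrite !(Rmult_comm (T (indicator _))) -!sc.
have le1 : gle (gscale (b - a) (indicator P)) (fun w => Rmax (Rmin (f w) b) a - a).
  move=> w; rewrite /gscale /indicator.
  case: (excluded_middle_informative (P w)) => /= [Pw|_].
    by rewrite Rmin_right; [rewrite Rmax_left|exact: Pf]; lra.
  by have := Rmax_r (Rmin (f w) b) a; lra.
have le2 : gle (fun w => Rmax (Rmin (f w) b) a - a) (gscale (b - a) (indicator Q)).
  move=> w; rewrite /gscale /indicator.
  case: (excluded_middle_informative (Q w)) => /= [_|nQ].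
    have := Rmin_r (f w) b => ?; have : Rmax (Rmin (f w) b) a <= b by apply: Rmax_lub.
    lra.
  have fa : f w <= a by apply: Rnot_lt_le => /fQ.
  by rewrite Rmax_right; [lra|have := Rmin_l (f w) b; lra].
have := exact_mono Tex gs (gi P) le1.
have := exact_mono Tex (gi Q) gs le2.
lra.
Qed.

Lemma real_Glb_Rbar (E : R -> Prop) (y0 M : R) :
  E y0 -> (forall y, E y -> M <= y) ->
  (forall y, E y -> real (Glb_Rbar E) <= y) /\
  (forall c, (forall y, E y -> c <= y) -> c <= real (Glb_Rbar E)).
Proof.
move=> E0 EM; have [lb glb] := Glb_Rbar_correct E.
move: lb glb; case: (Glb_Rbar E) => [l||] lb glb.
- by split=> [y|c] H; [exact: lb | exact: (glb (Rbar.Finite c) H)].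
- by have := lb _ E0.
- by have := glb (Rbar.Finite M) EM.
Qed.

Lemma ginf_le (Omega : Type) (f : Omega -> R) (w : Omega) : gamble f -> ginf f <= f w.
Proof.
move=> /gamble_bounds [M [lo _]].
have [|y [w' ->]|lb _] := @real_Glb_Rbar (fun y => exists w, y = f w) (f w) (- M).
- by exists w.
- exact: lo.
- by apply: lb; exists w.
Qed.

Lemma le_gsup (Omega : Type) (f : Omega -> R) (w : Omega) : gamble f -> f w <= gsup f.
Proof.
move=> /gamble_bounds [M [_ up]].
have [|y [w' ->]|ub _] := @real_Lub_Rbar (fun y => exists w, y = f w) (f w) M.
- by exists w.
- exact: up.
- by apply: ub; exists w.
Qed.

Lemma gmin_const_id (Omega : Type) (f : Omega -> R) (c : R) :
  (forall w, f w <= c) -> gmin f (gconst c) = f.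
Proof. by move=> le; extensionality w; exact: Rmin_left. Qed.

Lemma gmin_const_const (Omega : Type) (f : Omega -> R) (c : R) :
  (forall w, c <= f w) -> gmin f (gconst c) = gconst c.
Proof. by move=> le; extensionality w; exact: Rmin_right. Qed.

Lemma exact_supermodular_Choquet (Omega : Type) (T : functional Omega) (f : Omega -> R) :
  inhabited Omega -> exact_on_gambles T -> supermodular T -> gamble f ->
  is_Choquet (restrict_to_events T) f (T f).
Proof.
move=> [w0] Tex Tsup gf; split; [|split].
- move=> A B AB; apply: (exact_mono Tex); try exact: gamble_indicator.
  exact: gle_indicator.
- by rewrite /restrict_to_events indicator_False (exact_on_gambles_gconst 0 Tex); lra.
pose F x := T (gmin f (gconst x)).
exists (F (gsup f) - F (ginf f)); split.
  apply: (@is_RInt_of_increment_bounds _ F).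
    exact: Rle_trans (ginf_le w0 gf) (le_gsup w0 gf).
  by move=> x y xy; apply: truncation_increment_bounds => // w; lra.
(* Truncation at the supremum returns [f], and at the infimum a constant, whose value cancels the
   first summand of the Choquet integral. *)
rewrite /F gmin_const_id; last by move=> w; exact: le_gsup.
rewrite gmin_const_const; last by move=> w; exact: ginf_le.
by rewrite /restrict_to_events indicator_True (exact_on_gambles_gconst (ginf f) Tex); lra.
Qed.

(** * Comonotone additivity *)

(** The bounds on [u] say that both [u] and [t - u t] are nondecreasing. A McShane-type infimum of
    nondecreasing 1-Lipschitz functions of [t] has this property, and comonotonicity makes it take
    the prescribed values on the range of [f + g]. *)
Lemma comonotone_factor (Omega : Type) (f g : Omega -> R) :
  inhabited Omega -> gamble f -> comonotone f g ->
  exists u : R -> R, (forall w, u (f w + g w) = f w) /\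
    (forall s t, s <= t -> 0 <= u t - u s <= t - s).
Proof.
move=> [w0] /gamble_bounds [M [lo _]] com.
pose E t y := exists w, y = f w + Rmax 0 (t - (f w + g w)).
have spec t : (forall w, real (Glb_Rbar (E t)) <= f w + Rmax 0 (t - (f w + g w))) /\
    (forall c, (forall w, c <= f w + Rmax 0 (t - (f w + g w))) -> c <= real (Glb_Rbar (E t))).
  have [|y [w ->]|lb glb] := @real_Glb_Rbar (E t) (f w0 + Rmax 0 (t - (f w0 + g w0))) (- M).
  - by exists w0.
  - by have := lo w; rewrite /gconst; have := Rmax_l 0 (t - (f w + g w)); lra.
  - split=> [w|c H]; first by apply: lb; exists w.
    by apply: glb => y [w ->].
exists (fun t => real (Glb_Rbar (E t))); split=> [w|s t st].
  apply: Rle_antisym.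
    have := proj1 (spec (f w + g w)) w.
    by rewrite Rminus_diag Rmax_left; lra.
  apply: (proj2 (spec _)) => w'.
  (* If [f w' < f w], comonotonicity gives [g w' <= g w], so the increase of [f + g] from [w'] to
     [w] is at least that of [f]. *)
  case: (Rle_or_lt (f w) (f w')) => [|/com gw].
    by have := Rmax_l 0 (f w + g w - (f w' + g w')); lra.
  by have := Rmax_r 0 (f w + g w - (f w' + g w')); lra.
have [lbs glbs] := spec s; have [lbt glbt] := spec t; split.
  have : real (Glb_Rbar (E s)) <= real (Glb_Rbar (E t)); last lra.
  apply: glbt => w; apply: (Rle_trans _ _ _ (lbs w)).
  by rewrite /Rmax; do !case: Rle_dec; lra.
have : real (Glb_Rbar (E t)) - (t - s) <= real (Glb_Rbar (E s)); last lra.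
apply: glbs => w; have := lbt w.
by rewrite /Rmax; do !case: Rle_dec; lra.
Qed.

(* With h = f + g, write f = u h and g = v h where u, v are nondecreasing and
   u + v = id.  Then t |-> T (f /\ u t) + T (g /\ v t) satisfies the same
   increment bounds as t |-> T (h /\ t), hence differs from it by a constant. *)
Lemma exact_supermodular_comonotone_additive (Omega : Type) (T : functional Omega) :
  inhabited Omega -> exact_on_gambles T -> supermodular T -> comonotone_additive T.
Proof.
move=> inh Tex Tsup f g /dom_gamble gf /dom_gamble gg /dom_gamble gh com.
have [u [uh uincr]] := comonotone_factor inh gf com.
pose v t := t - u t.
pose m x := T (indicator (fun w => x <= gadd f g w)).
pose F t := T (gmin (gadd f g) (gconst t)).
pose F' t := T (gmin f (gconst (u t))) + T (gmin g (gconst (v t))).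
have boundsF x y : x <= y -> m y * (y - x) <= F y - F x <= m x * (y - x).
  by move=> xy; apply: truncation_increment_bounds => // w; lra.
have boundsF' x y : x <= y -> m y * (y - x) <= F' y - F' x <= m x * (y - x).
  move=> xy; have uxy := uincr _ _ xy.
  have := @truncation_increment_bounds _ T f (fun w => y <= gadd f g w)
    (fun w => x <= gadd f g w) (u x) (u y) Tex Tsup gf ltac:(lra).
  have := @truncation_increment_bounds _ T g (fun w => y <= gadd f g w)
    (fun w => x <= gadd f g w) (v x) (v y) Tex Tsup gg ltac:(rewrite /v; lra).
  rewrite -/(m x) -/(m y) => bg bf.
  have {}bf : m y * (u y - u x) <=
      T (gmin f (gconst (u y))) - T (gmin f (gconst (u x))) <= m x * (u y - u x).
    (* Monotonicity of [u] turns [y <= f w + g w] into [u y <= f w]; contrapositively, [u x < f w]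
       forces [x <= f w + g w]. *)
    apply: bf => w; have := uh w; rewrite /gadd => e; first by move/uincr; lra.
    by move=> lt; apply: Rnot_lt_le => /Rlt_le /uincr; lra.
  have {}bg : m y * (v y - v x) <=
      T (gmin g (gconst (v y))) - T (gmin g (gconst (v x))) <= m x * (v y - v x).
    apply: bg => w; have := uh w; rewrite /gadd /v => e; first by move/uincr; lra.
    by move=> lt; apply: Rnot_lt_le => /Rlt_le /uincr; lra.
  move: bf bg; rewrite /F' /v; lra.
have [M [lo up]] := gamble_bounds gh.
case: (inh) => w0; have MM : - M <= M by have := lo w0; have := up w0; rewrite /gconst; lra.
(* By uniqueness of the integral of [m], [F] and [F'] have the same increment over [[- M, M]]. *)
have := is_RInt_unique _ _ _ _ (is_RInt_of_increment_bounds MM boundsF).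
rewrite (is_RInt_unique _ _ _ _ (is_RInt_of_increment_bounds MM boundsF')).
have uvM w : (f w <= u M /\ g w <= v M) /\ (u (- M) <= f w /\ v (- M) <= g w).
  have := uh w; have /uincr := lo w; have /uincr := up w.
  by rewrite /v /gconst /gadd; lra.
have top k c : (forall w, k w <= c) -> T (gmin k (gconst c)) = T k.
  by move=> ?; rewrite gmin_const_id.
have bot k c : (forall w, c <= k w) -> T (gmin k (gconst c)) = c * T (gconst 1).
  by move=> ?; rewrite gmin_const_const // exact_on_gambles_gconst.
rewrite /F /F' (top _ M) // (top _ (u M)); last by move=> w; apply uvM.
rewrite (top _ (v M)); last by move=> w; apply uvM.
(* At [- M] all truncations are constant, and the values of [F] and [F'] agree because
   [u (- M) + v (- M) = - M]. Equality at [M] remains, which is additivity. *)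
rewrite (bot _ (- M)) // (bot _ (u (- M))); last by move=> w; apply uvM.
rewrite (bot _ (v (- M))); last by move=> w; apply uvM.
by rewrite /v; lra.
Qed.

(** * The three properties of the natural extension *)

Theorem corollary19 (Omega : Type) (Omega_nonempty : inhabited Omega)
    (n : option nat) (n_ge2 : le_order 2 n)
    (G : functional Omega)
    (G_lattice : linear_lattice (dom G))
    (G_constants : forall mu : R, dom G (gconst mu))
    (G_exact : exact G)
    (G_monotone : n_monotone n G) :
  n_monotone n (natural_extension G) /\
  comonotone_additive (natural_extension G) /\
  (forall f : Omega -> R, gamble f ->
     is_Choquet (restrict_to_events (inner_extension G)) f (natural_extension G f)).
Proof.
rewrite natural_extension_inner //.
have Tex := inner_extension_exact G_exact G_lattice G_constants.
have Tmono := inner_extension_n_monotone G_exact G_lattice G_constants G_monotone.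
have Tsup := n_monotone_supermodular n_ge2 Tmono.
split=> //; split=> [|f gf].
  exact: exact_supermodular_comonotone_additive.
exact: exact_supermodular_Choquet.
Qed.
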